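(* Let $X$ be a strictly convex reflexive Banach space of dimension at least $2$, and let $S\subseteq X$ be a countable dense set with no repeated distance. Then $S$ is strongly non-Rado.
   Context: All normed spaces are real. Let $S$ be a countable dense set in a normed space $X$, and let $p$ be a fixed probability with $0<p<1$. The random graph $G(S,p)$ has vertex set $S$; each pair of distinct points $x,y\in S$ with $\|x-y\|<1$ is joined by an edge with probability $p$, independently over all such pairs, and no other pairs are joined. The set $S$ is strongly non-Rado if any two such random graphs are almost surely non-isomorphic (as abstract graphs), i.e. two independent samples of $G(S,p)$ are non-isomorphic with probability $1$. The set $S$ has no repeated distance if the distances $\|x-y\|$, over unordered pairs $\{x,y\}$ of distinct points of $S$, are pairwise distinct. $X$ is strictly convex if every point of the unit sphere is an extreme point of the closed unit ball. *)

(* Defs.v *)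
From HB Require Import structures.
From mathcomp Require Import all_boot all_order all_algebra finmap.
From mathcomp Require Import all_classical all_reals all_analysis.

Set Implicit Arguments.
Unset Strict Implicit.
Unset Printing Implicit Defensive.

Import Order.TTheory GRing.Theory Num.Theory.
Import numFieldNormedType.Exports.

Local Open Scope classical_set_scope.
Local Open Scope ring_scope.

Section Spaces.
Context {R : realType}.

Definition extreme_point (V : lmodType R) (C : set V) (x : V) : Prop :=
  C x /\ forall (y z : V) (t : R), C y -> C z -> 0 < t < 1 ->
    x = t *: y + (1 - t) *: z -> y = x /\ z = x.

Definition unit_ball (X : normedModType R) : set X := [set x | `|x| <= 1].

Definition strictly_convex (X : normedModType R) : Prop :=
  forall x : X, `|x| = 1 -> extreme_point (@unit_ball X) x.

(* The dual space X^*, carved out of the module of all functions X -> R. *)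
Definition dual (X : normedModType R) : set (X -> R^o) :=
  [set f | linear f /\ continuous f].

Definition dual_norm (X : normedModType R) (f : X -> R^o) : R :=
  sup [set `|f x| | x in @unit_ball X].

(* An element of X^** is a map Phi whose restriction to X^* is linear and
   bounded for the dual norm; the values of Phi off X^* are irrelevant. *)
Definition bidual (X : normedModType R) (Phi : (X -> R^o) -> R) : Prop :=
  (forall (a : R) (f g : X -> R^o), dual f -> dual g ->
     Phi (a *: f + g) = a * Phi f + Phi g) /\
  (exists C : R, forall f : X -> R^o, dual f -> `|Phi f| <= C * dual_norm f).

(* Surjectivity of the canonical map x |-> (f |-> f x) from X to X^**. *)
Definition reflexive_space (X : normedModType R) : Prop :=
  forall Phi : (X -> R^o) -> R, bidual Phi ->
    exists x : X, forall f : X -> R^o, dual f -> Phi f = f x.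

Definition dim_ge2 (V : lmodType R) : Prop :=
  exists u v : V, forall a b : R, a *: u + b *: v = 0 -> a = 0 /\ b = 0.

Definition no_repeated_distance (X : normedModType R) (S : set X) : Prop :=
  forall x y u v : X, S x -> S y -> S u -> S v -> x <> y -> u <> v ->
    `|x - y| = `|u - v| -> [set x; y] = [set u; v].

End Spaces.

(* A graph with vertex set S is given by its set of edges, an edge being a
   two-element subset of S. *)
Definition graph_iso (V : Type) (S : set V) (G H : set (set V)) : Prop :=
  exists f : V -> V, set_bij S S f /\
    forall x y : V, S x -> S y -> x <> y ->
      (G [set x; y] <-> H [set f x; f y]).

Section RandomGraphs.
Context {R : realType} {d : measure_display} {T : measurableType d}.
Variable P : probability T R.

Definition mutually_independent (I : choiceType) (D : set I)
    (A : I -> set T) : Prop :=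
  forall F : {fset I}, [set` F] `<=` D ->
    P (\bigcap_(i in [set` F]) A i) = (\prod_(i <- F) P (A i))%E.

Variables (X : normedModType R) (S : set X) (p : R).

Definition near_pairs : set (set X) :=
  [set e | exists x y : X,
     [/\ S x, S y, x <> y, `|x - y| < 1 & e = [set x; y]]].

Definition edge_event (G : T -> set (set X)) (e : set X) : set T :=
  [set w | G w e].

(* G is a sample of G(S, p). *)
Definition random_graph (G : T -> set (set X)) : Prop :=
  [/\ (forall w : T, G w `<=` near_pairs),
      (forall e, near_pairs e -> measurable (edge_event G e)),
      (forall e, near_pairs e -> P (edge_event G e) = p%:E)
    & mutually_independent near_pairs (edge_event G)].

Definition graph_sigma (G : T -> set (set X)) : set (set T) :=
  <<s [set edge_event G e | e in near_pairs] >>.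

Definition independent_graphs (G H : T -> set (set X)) : Prop :=
  forall A B : set T, graph_sigma G A -> graph_sigma H B ->
    P (A `&` B) = (P A * P B)%E.

End RandomGraphs.

(* Only the joint law of the two samples matters, so the probability space
   carrying them is arbitrary. *)
Definition strongly_non_rado {R : realType} (X : normedModType R)
    (S : set X) (p : R) : Prop :=
  forall (d : measure_display) (T : measurableType d) (P : probability T R)
    (G H : T -> set (set X)),
    random_graph P S p G -> random_graph P S p H ->
    independent_graphs P S G H ->
    {ae P, forall w, ~ graph_iso S (G w) (H w)}.

(* Main.v *)
(* Almost surely, any two distinct points of S at distance less than 2 have a
   common neighbour in both graphs, so an isomorphism f : S -> S preserves the
   relation |x - y| < 2, hence |x - y| < 2n for every n >= 1.  In a reflexive
   space such an f extends to a map F of X: F x is the unique common point of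
   the closed balls B(f s, 2n) with s in S and |x - s| < 2n, which exists by
   weak compactness.  F again preserves |x - y| < 2n and also |x - y| = 2n for
   n >= 4, so by strict convexity it maps x, x + v, x + 2v, ... to an arithmetic
   progression when |v| = 8; since F is an isometry up to an additive constant,
   the increment F (x + v) - F x does not depend on x.  In dimension at least 2
   every short vector is a sum of two vectors of norm 8, so F is locally affine
   and an isometry.  Without repeated distances f is then the identity of S,
   which is almost surely not an isomorphism of two independent samples. *)
Require Import Defs.
From HB Require Import structures.
From mathcomp Require Import all_boot all_order all_algebra finmap.
From mathcomp Require Import all_classical all_reals all_analysis.
From mathcomp Require Import ring lra.
Import Order.TTheory GRing.Theory Num.Theory.
Import numFieldNormedType.Exports.
Local Open Scope classical_set_scope.
Local Open Scope ring_scope.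

Set Implicit Arguments.
Unset Strict Implicit.
Unset Printing Implicit Defensive.

(** * Hahn-Banach *)

Definition sublinear (R : realType) (V : lmodType R) (q : V -> R) : Prop :=
  (forall x y, q (x + y) <= q x + q y) /\
  (forall t x, 0 <= t -> q (t *: x) = t * q x).

Lemma sublinear0 (R : realType) (V : lmodType R) (q : V -> R) :
  sublinear q -> q 0 = 0.
Proof. by move=> [_ /(_ 0 0 (lexx _))]; rewrite scale0r mul0r. Qed.

Lemma sublinear_oppr (R : realType) (V : lmodType R) (q : V -> R) (x : V) :
  sublinear q -> - q (- x) <= q x.
Proof.
move=> qs; have := sublinear0 qs; have := qs.1 x (- x); rewrite subrr.
by move=> + q0; rewrite q0; lra.
Qed.

(** Of two members of a chain the smaller one can be used at both [x] and [y], which gives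
    subadditivity; the minorant [b] keeps the infima finite. This bounds chains in the application
    of Zorn's lemma. *)
Lemma sublinear_inf (R : realType) (V : lmodType R) (A : set (V -> R))
    (q0 : V -> R) (b : V -> R) :
  A q0 -> (forall q, A q -> sublinear q) ->
  (forall q x, A q -> b x <= q x) ->
  (forall q1 q2, A q1 -> A q2 ->
     (forall x, q1 x <= q2 x) \/ (forall x, q2 x <= q1 x)) ->
  sublinear (fun x => inf [set q x | q in A]).
Proof.
move=> Aq0 Asub Ab Atot.
have lbA x : has_lbound [set q x | q in A].
  by exists (b x) => _ [q Aq <-]; exact: Ab.
have neA x : [set q x | q in A] !=set0 by exists (q0 x), q0.
have infA q x : A q -> inf [set q x | q in A] <= q x.
  by move=> Aq; apply: ge_inf => //; exists q.
split=> [x y|t x t0].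
- rewrite -lerBlDr; apply: lb_le_inf => // _ [q1 Aq1 <-].
  rewrite lerBlDl -lerBlDr; apply: lb_le_inf => // _ [q2 Aq2 <-].
  rewrite lerBlDl.
  have [h|h] := Atot _ _ Aq1 Aq2.
  + apply: (le_trans (infA _ _ Aq1)); apply: (le_trans ((Asub _ Aq1).1 x y)).
    by rewrite lerD2l.
  + apply: (le_trans (infA _ _ Aq2)); apply: (le_trans ((Asub _ Aq2).1 x y)).
    by rewrite lerD2r.
- apply/eqP; rewrite eq_le; apply/andP; split.
  + have [->|tn0] := eqVneq t 0.
      rewrite mul0r scale0r; apply: (le_trans (infA _ _ Aq0)).
      by rewrite (sublinear0 (Asub _ Aq0)).
    have tp : 0 < t by rewrite lt_def tn0.
    rewrite mulrC -ler_pdivrMr//; apply: lb_le_inf => // _ [q Aq <-].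
    rewrite ler_pdivrMr// mulrC -(Asub _ Aq).2//; exact: infA.
  + apply: lb_le_inf => // _ [q Aq <-].
    by rewrite (Asub _ Aq).2// ler_wpM2l// infA.
Qed.

(** The classical auxiliary functional of Hahn-Banach: for sublinear [q] it is again sublinear, lies
    below [q], and is at most [- q y] at [- y] (take [t = 1]). *)
Definition sublinear_along (R : realType) (V : lmodType R) (q : V -> R)
    (y x : V) :=
  inf [set q (x + t *: y) - t * q y | t in [set t | 0 <= t]].

Section SublinearAlong.
Context (R : realType) (V : lmodType R) (q : V -> R) (y : V).
Hypothesis qs : sublinear q.

Let values_ge (x : V) :
  lbound [set q (x + t *: y) - t * q y | t in [set t | 0 <= t]] (- q (- x)).
Proof.
move=> _ [t /= t0 <-]; have := qs.1 (x + t *: y) (- x).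
by rewrite addrAC subrr add0r qs.2//; lra.
Qed.

Lemma sublinear_along_le (t : R) (x : V) :
  0 <= t -> sublinear_along q y x <= q (x + t *: y) - t * q y.
Proof. by move=> t0; apply: ge_inf; [exists (- q (- x))|exists t]. Qed.

Lemma sublinear_along_le_base (x : V) : sublinear_along q y x <= q x.
Proof.
by have := @sublinear_along_le 0 x (lexx _); rewrite scale0r addr0 mul0r subr0.
Qed.

Lemma sublinear_along_sublinear : sublinear (sublinear_along q y).
Proof.
have ne x : [set q (x + t *: y) - t * q y | t in [set t | 0 <= t]] !=set0.
  by exists (q (x + 0 *: y) - 0 * q y); exists 0 => //=.
split=> [x z|s x s0].
- rewrite -lerBlDr; apply: lb_le_inf => // _ [t /= t0 <-].
  rewrite lerBlDl -lerBlDr; apply: lb_le_inf => // _ [u /= u0 <-].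
  rewrite lerBlDl; apply: (le_trans (sublinear_along_le _ (addr_ge0 t0 u0))).
  have := qs.1 (x + t *: y) (z + u *: y).
  by rewrite addrACA -scalerDl mulrDl; lra.
- have [->|sn0] := eqVneq s 0.
    rewrite scale0r mul0r; apply/eqP; rewrite eq_le; apply/andP; split.
      by rewrite (le_trans (sublinear_along_le_base _))// (sublinear0 qs).
    apply: lb_le_inf => // r hr; have := values_ge hr.
    by rewrite oppr0 (sublinear0 qs) oppr0.
  have sp : 0 < s by rewrite lt_def sn0.
  apply/eqP; rewrite eq_le; apply/andP; split.
  + rewrite mulrC -ler_pdivrMr//; apply: lb_le_inf => // _ [t /= t0 <-].
    rewrite ler_pdivrMr//.
    apply: (le_trans (sublinear_along_le _ (mulr_ge0 s0 t0))).
    by rewrite -scalerA -scalerDr qs.2//; lra.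
  + apply: lb_le_inf => // _ [t /= t0 <-].
    have -> : s *: x + t *: y = s *: (x + (t / s) *: y).
      by rewrite scalerDr scalerA mulrC divfK.
    rewrite qs.2// -[X in _ - X * _](divfK sn0) [t / s * s]mulrC -mulrA -mulrBr.
    by rewrite ler_wpM2l// sublinear_along_le// divr_ge0.
Qed.

End SublinearAlong.

(* A minimal sublinear functional coincides with [sublinear_along q y] for
   every [y]; evaluating at [- y] shows that it is odd, hence additive. *)
Lemma linear_below_sublinear (R : realType) (V : lmodType R) (p : V -> R) :
  sublinear p ->
  exists g : V -> R^o, linear g /\ forall x, g x <= p x.
Proof.
move=> ps.
pose T := {q : V -> R | sublinear q /\ forall x, q x <= p x}.
pose mkT q (qs : sublinear q) (qp : forall x, q x <= p x) : T :=
  exist (fun q => sublinear q /\ forall x, q x <= p x) q (conj qs qp).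
(* The order is reversed, so a maximal element for [r] is a pointwise minimal functional. *)
pose r (a b : T) := `[< forall x, sval b x <= sval a x >].
have [||[a Pa] [b Pb] /asboolP/= ab /asboolP/= ba|A Atot|[q [qs qp]] qmin] :=
  @Zorn T r.
- by move=> ?; apply/asboolP.
- move=> a b c /asboolP ab /asboolP bc; apply/asboolP => x.
  exact: le_trans (bc x) (ab x).
- by apply/eq_exist/funext => x; apply/eqP; rewrite eq_le ab ba.
- have [[a0 Aa0]|A0] := pselect (A !=set0); last first.
    exists (mkT p ps (fun x => lexx _)) => s As.
    by exfalso; apply: A0; exists s.
  pose B := [set sval a | a in A].
  have Bb q x : B q -> - p (- x) <= q x.
    move=> [a Aa <-]; have [as_ ap] := svalP a.
    by apply: le_trans (sublinear_oppr x as_); rewrite lerN2 ap.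
  have Bs q : B q -> sublinear q by move=> [a Aa <-]; have [] := svalP a.
  have Bq0 : B (sval a0) by exists a0.
  have is_ : sublinear (fun x => inf [set q x | q in B]).
    apply: (@sublinear_inf _ _ B _ (fun x => - p (- x)) Bq0 Bs Bb) =>
      _ _ [a Aa <-] [b Ab <-].
    by have [/asboolP|/asboolP] := Atot _ _ Aa Ab; [right|left].
  have iB q x : B q -> inf [set q x | q in B] <= q x.
    by move=> Bq; apply: ge_inf; [exists (- p (- x)) => _ [q' Bq' <-];
      exact: Bb|exists q].
  have ip x : inf [set q x | q in B] <= p x.
    by apply: (le_trans (iB _ _ Bq0)); have [_] := svalP a0; exact.
  exists (mkT _ is_ ip) => s As; apply/asboolP => x /=.
  by apply: iB; exists s.
- have qE y x : q x <= sublinear_along q y x.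
    have ys := sublinear_along_sublinear y qs.
    have yp z : sublinear_along q y z <= p z.
      exact: le_trans (sublinear_along_le_base y qs z) (qp z).
    have := qmin (mkT _ ys yp).
    move=> /(_ _)/(congr1 sval)/= => -> //.
    by apply/asboolP => z /=; exact: sublinear_along_le_base.
  have qN y : q (- y) = - q y.
    apply/eqP; rewrite eq_le; apply/andP; split; last first.
      by have := sublinear_oppr y qs; lra.
    apply: (le_trans (qE y _)).
    apply: (le_trans (sublinear_along_le y qs _ ler01)).
    by rewrite scale1r addNr (sublinear0 qs) mul1r sub0r.
  have qD x y : q (x + y) = q x + q y.
    apply/eqP; rewrite eq_le qs.1/=.
    by have := qs.1 (- x) (- y); rewrite -opprD !qN; lra.
  exists q; split => // a x y; rewrite qD; congr (_ + _).
  change (q (a *: x) = a * q x).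
  have [a0|a0] := leP 0 a; first by rewrite qs.2.
  rewrite -[a]opprK scaleNr qN qs.2 ?oppr_ge0 1?ltW//.
  by rewrite !mulNr !opprK.
Qed.

Lemma norm_sublinear (R : realType) (X : normedModType R) :
  sublinear (fun x : X => `|x|).
Proof. by split=> [|t x t0]; [exact: ler_normD|rewrite normrZ ger0_norm]. Qed.

(** A linear functional below [sublinear_along] of the norm in direction [z] lies below the norm and
    is at most [- |z|] at [- z], hence at least [|z|] at [z]. *)
Lemma norming_functional (R : realType) (X : normedModType R) (z : X) :
  exists g : X -> R^o,
    [/\ linear g, forall x, `|g x| <= `|x| & g z = `|z|].
Proof.
have ns := @norm_sublinear R X.
have [g [glin gp]] := linear_below_sublinear
  (sublinear_along_sublinear (z : X) ns).
have gN x : g (- x) = - g x.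
  have g0 : g 0 = 0.
    by have := glin (-1) 0 0; rewrite scaler0 addr0 scaleN1r addNr.
  by have := glin (-1) x 0; rewrite addr0 scaleN1r g0 addr0 scaleN1r.
have gn x : g x <= `|x| := le_trans (gp x) (sublinear_along_le_base z ns x).
have gn' x : `|g x| <= `|x|.
  by rewrite ler_norml gn andbT lerNl -gN -[X in _ <= X]normrN gn.
exists g; split => //; apply/eqP; rewrite eq_le gn/= -lerN2 -gN.
apply: (le_trans (gp _)); apply: (le_trans (sublinear_along_le z ns _ ler01)).
by rewrite scale1r addNr normr0 mul1r sub0r.
Qed.

(** * Weak limits in reflexive spaces *)

(** The image filter clusters in a compact segment, and an ultrafilter converges to each of its
    cluster points. *)
Lemma ultra_bounded_cvg (R : realType) (T : Type) (U : set_system T)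
    (g : T -> R) (M : R) :
  UltraFilter U -> U [set x | `|g x| <= M] ->
  exists l : R, g x @[x --> U] --> l.
Proof.
move=> UU UM; have UP : ProperFilter U by exact: ultra_proper.
have gM : (g @ U) `[- M, M]%classic.
  suff : U (g @^-1` `[- M, M]%classic) by [].
  by apply: filterS UM => x /=; rewrite in_itv/= -ler_norml.
have [l [_ cl]] := segment_compact (fmap_proper_filter g UP) gM.
exists l => V Vl; have [//|UnV] := in_ultra_setVsetC (g @^-1` V) UU.
by have [y [nVy Vy]] := cl (~` V) V UnV Vl.
Qed.

Section DualNorm.
Context (R : realType) (X : normedModType R) (f : X -> R^o).
Hypothesis df : dual f.

Let F : {linear X -> R^o} :=
  HB.pack f (GRing.isLinear.Build _ _ _ _ f df.1).

Let f0 : f 0 = 0 := linear0 F.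

Let fZ (a : R) (x : X) : f (a *: x) = a *: f x := linearZ_LR F a x.

Let dual_has_ubound : has_ubound [set `|f x| | x in @unit_ball R X].
Proof.
have /linear_boundedP/pinfty_ex_gt0[r r0 fr] : bounded_near F (nbhs (0 : X)).
  exact/linear_bounded_continuous/(df.2).
exists r => _ [y /= y1 <-]; apply: le_trans (fr y) _.
by rewrite -[leRHS]mulr1 ler_wpM2l// ltW.
Qed.

Lemma dual_norm_ge0 : 0 <= dual_norm f.
Proof.
apply: ub_le_sup => //; exists 0; first by rewrite /unit_ball/= normr0.
by rewrite f0 normr0.
Qed.

Lemma dual_bound (x : X) : `|f x| <= dual_norm f * `|x|.
Proof.
have [->|x0] := eqVneq x 0.
  by rewrite f0 !normr0 mulr0.
have nx : 0 < `|x| by rewrite normr_gt0.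
rewrite -ler_pdivrMr//; apply: ub_le_sup => //.
exists (`|x|^-1 *: x).
  by rewrite /unit_ball/= normrZ normfV normr_id mulVf// gt_eqF.
by rewrite fZ normrZ normfV normr_id mulrC.
Qed.

End DualNorm.

Lemma linear_le_norm_dual (R : realType) (X : normedModType R) (g : X -> R^o) :
  linear g -> (forall x, `|g x| <= `|x|) -> dual g.
Proof.
move=> glin gn; split=> //.
pose F : {linear X -> R^o} := HB.pack g (GRing.isLinear.Build _ _ _ _ g glin).
apply: (bounded_linear_continuous (f := F)); apply/bounded_funP => r.
by exists r => x xr; exact: le_trans (gn x) xr.
Qed.

(* A weak cluster point; closed balls are weakly closed by Hahn-Banach. *)
Lemma reflexive_ultra_limit (R : realType) (X : normedModType R)
    (U : set_system X) (M : R) :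
  reflexive_space X -> UltraFilter U -> U [set x | `|x| <= M] ->
  exists z : X, forall w r, U [set x | `|x - w| <= r] -> `|z - w| <= r.
Proof.
move=> Xrefl UU UM; have UP : ProperFilter U by exact: ultra_proper.
(* The limit of evaluations along [U] is linear on the dual and bounded by [M] times the dual norm;
   reflexivity represents it by a point [z]. *)
pose Phi (f : X -> R^o) : R := lim ((f : X -> R) x @[x --> U]).
have UMf f : dual f -> U [set x | `|f x| <= M * dual_norm f].
  move=> df; apply: filterS UM => x /= xM; apply: (le_trans (dual_bound df x)).
  by rewrite mulrC ler_wpM2r// dual_norm_ge0.
have PhiP f : dual f -> (f : X -> R) x @[x --> U] --> Phi f.
  move=> df; have [l fl] := ultra_bounded_cvg UU (UMf f df).
  by rewrite /Phi (cvg_lim _ fl).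
have [|z zP] := Xrefl Phi.
  split=> [a f g df dg|].
  - apply: cvg_lim => //.
    by apply: cvgD; [apply: cvgM; [exact: cvg_cst|exact: PhiP]|exact: PhiP].
  - exists M => f df; have /cvg_norm cf := PhiP _ df.
    apply: (cvgr_to_le cf); exact: UMf.
exists z => w r Ur.
(* Every [x] in the ball satisfies [g x <= r + g w], and this passes to the limit [g z]. *)
have [g [glin gn gz]] := norming_functional (z - w).
have dg : dual g by exact: linear_le_norm_dual.
have gB x y : g (x - y) = g x - g y.
  pose G : {linear X -> R^o} := HB.pack g (GRing.isLinear.Build _ _ _ _ g glin).
  exact: (linearB G).
rewrite -gz gB -(zP _ dg) lerBlDr.
apply: (cvgr_to_le (PhiP _ dg)).
apply: filterS Ur => x /= xr; rewrite -lerBlDr -gB.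
exact: le_trans (ler_norm _) (le_trans (gn _) xr).
Qed.

(** * Dense sets and step maps *)

Section DensePoints.
Context (R : realType) (X : normedModType R) (S : set X).
Hypothesis Sd : dense S.

Lemma dense_norm_ball (x : X) (e : R) :
  0 < e -> exists t, S t /\ `|t - x| < e.
Proof.
move=> e0; have /Sd : ball x e !=set0 by exists x; exact: ballxx.
move=> /(_ (ball_open _ _)) [t []].
by rewrite -ball_normE/= => xt St; exists t; rewrite distrC.
Qed.

Lemma dense_between (x y : X) (a b : R) :
  0 < a -> 0 < b -> `|x - y| < a + b ->
  exists t, [/\ S t, `|x - t| < a & `|t - y| < b].
Proof.
move=> a0 b0 xy; have ab : 0 < a + b by rewrite addr_gt0.
have abn : a + b != 0 by rewrite gt_eqF.
pose k := `|x - y| / (a + b).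
have k1 : k < 1 by rewrite /k ltr_pdivrMr// mul1r.
have k0 : 0 <= k by rewrite /k divr_ge0// ltW.
have kxy : k * (a + b) = `|x - y| by rewrite /k divfK.
(* The point dividing the segment in the ratio [a : b] is at distance [a * k] from [x] and [b * k]
   from [y] with [k < 1], which leaves room to move into [S]. *)
pose u := x + (a / (a + b)) *: (y - x).
have ux : `|x - u| = a * k.
  rewrite /u opprD addNKr normrN normrZ ger0_norm ?divr_ge0 ?(ltW a0)
    ?(ltW ab)//.
  by rewrite distrC /k; field.
have uy : `|u - y| = b * k.
  have -> : u - y = (b / (a + b)) *: (x - y).
    have -> : b / (a + b) = 1 - a / (a + b) by field.
    by rewrite scalerBl scale1r -[x - y]opprB scalerN opprK addrAC opprB.
  by rewrite normrZ ger0_norm ?divr_ge0 ?(ltW b0) ?(ltW ab)// /k; field.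
have e0 : 0 < Num.min (a - a * k) (b - b * k).
  by rewrite lt_min !subr_gt0 !gtr_pMr// k1.
have [t [St]] := dense_norm_ball u e0; rewrite lt_min => /andP[ta tb].
exists t; split => //.
- have := ler_distD u x t; rewrite ux (distrC u t); lra.
- have := ler_distD u t y; rewrite uy; lra.
Qed.

Lemma dense_beyond (x s : X) (c : R) (n : nat) :
  0 < c -> c * n%:R < `|x - s| ->
  exists t, [/\ S t, `|t - x| < c * 2%:R & c * (n + 2)%:R <= `|t - s|].
Proof.
move=> c0 xs; have xs0 : 0 < `|x - s|.
  by apply: le_lt_trans xs; rewrite mulr_ge0// ltW.
pose d := Num.min (`|x - s| - c * n%:R) c.
have d0 : 0 < d by rewrite lt_min subr_gt0 xs.
have dc : d <= c by rewrite ge_min lexx orbT.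
have dx : d <= `|x - s| - c * n%:R by rewrite ge_min lexx.
(* Moving from [x] straight away from [s] by almost [2c] loses [d / 2], and the approximation in [S]
   loses less than another [d / 2]; the excess of [|x - s|] over [c * n] pays for both. *)
pose l := c * 2%:R - d / 2.
have l0 : 0 < l by rewrite /l; lra.
pose y := x + (l / `|x - s|) *: (x - s).
have yx : `|y - x| = l.
  rewrite /y addrAC subrr add0r normrZ ger0_norm ?divr_ge0 ?(ltW l0)//.
  by rewrite divfK// gt_eqF.
have ys : `|y - s| = `|x - s| + l.
  have -> : y - s = (1 + l / `|x - s|) *: (x - s).
    by rewrite scalerDl scale1r /y addrAC.
  rewrite normrZ ger0_norm ?addr_ge0 ?divr_ge0 ?(ltW l0)//.
  by rewrite mulrDl mul1r divfK// gt_eqF.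
have d20 : 0 < d / 2 by lra.
have [t [St ty]] := dense_norm_ball y d20.
exists t; split => //.
- have := ler_distD y t x; rewrite yx /l; lra.
- have := ler_distD t y s; rewrite ys (distrC y t) natrD mulrDr /l; lra.
Qed.

End DensePoints.

(** * Step maps on a dense set and their extension to the whole space *)

Lemma step_map_chain (R : realType) (X : normedModType R) (S : set X)
    (c : R) (f : X -> X) :
  dense S -> 0 < c ->
  (forall s t, S s -> S t -> `|s - t| < c -> `|f s - f t| < c) ->
  forall n s t, S s -> S t ->
    `|s - t| < c * n%:R -> `|f s - f t| < c * n%:R.
Proof.
move=> Sd c0 fc; elim=> [|n IHn] s t Ss St.
  by rewrite mulr0 normr_lt0.
case: n => [|n] in IHn *; first by rewrite mulr1; exact: fc.
rewrite -[n.+2]add1n natrD mulrDr mulr1 => st.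
have cn0 : 0 < c * n.+1%:R by rewrite mulr_gt0.
have [u [Su su ut]] := dense_between Sd c0 cn0 st.
have := fc _ _ Ss Su su; have := IHn _ _ Su St ut.
by have := ler_distD (f u) (f s) (f t); lra.
Qed.

(** The candidates for the value at [x] of an extension of [f]. The balls are closed so that weak
    limits stay in them; strict inequalities are recovered in [step_image_lt]. *)
Definition step_image (R : realType) (X : normedModType R) (S : set X)
    (c : R) (f : X -> X) (x : X) : set X :=
  [set z | forall s n, S s -> `|x - s| < c * n%:R -> `|z - f s| <= c * n%:R].

Section StepExtension.
Context (R : realType) (X : normedModType R) (S : set X) (c : R).
Context (f g : X -> X).
Hypotheses (Sd : dense S) (c0 : 0 < c).
Hypothesis gS : forall s, S s -> S (g s).
Hypothesis gK : forall s, S s -> f (g s) = s.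
Hypothesis fstep : forall s t n, S s -> S t ->
  (`|s - t| < c * n%:R) = (`|f s - f t| < c * n%:R).

(** A candidate is a weak limit of [f y] along an ultrafilter of points [y] of [S] tending to [x]:
    if [|x - s| < c * n], the same holds for all [y] near [x], and [f] preserves it. *)
Lemma step_image_nonempty (x : X) :
  reflexive_space X -> step_image S c f x !=set0.
Proof.
move=> Xrefl.
have FP : ProperFilter (within S (nbhs x)).
  apply: within_nbhs_proper => A /nbhs_ballP[e /= e0 eA].
  have [t [St tx]] := dense_norm_ball Sd x e0.
  by exists t; split=> //; apply: eA; rewrite -ball_normE/= distrC.
have [U [UU FU]] := ultraFilterLemma (fmap_proper_filter f FP).
have near_image s n : S s -> `|x - s| < c * n%:R ->
    U [set z | `|z - f s| <= c * n%:R].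
  move=> Ss xs; apply: FU.
  suff : \forall y \near x, S y -> `|f y - f s| <= c * n%:R by [].
  have e0 : 0 < c * n%:R - `|x - s| by rewrite subr_gt0.
  apply/nbhs_ballP; exists (c * n%:R - `|x - s|) => //= y.
  rewrite -ball_normE/= => xy Sy; rewrite ltW// -fstep//.
  by have := ler_distD x y s; rewrite (distrC y x); lra.
have [s0 [Ss0 sx]] := dense_norm_ball Sd x c0.
have UM : U [set z | `|z| <= c + `|f s0|].
  have := near_image s0 1%N Ss0; rewrite mulr1 distrC => /(_ sx).
  have UF : Filter U by exact: (@ultra_proper _ _ UU).
  apply: filterS => z /= zs.
  by have := ler_normD (z - f s0) (f s0); rewrite subrK; lra.
have [z zP] := reflexive_ultra_limit Xrefl UU UM.
by exists z => s n Ss xs; apply: zP; exact: near_image.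
Qed.

(** A point [t] of [S] within [2c] of [x] but at least [c * (n + 2)] from [s] keeps both bounds
    under [f], and the triangle inequality returns [c * n]. *)
Lemma step_image_ge (x z s : X) (n : nat) :
  step_image S c f x z -> S s -> c * n%:R < `|x - s| -> c * n%:R <= `|z - f s|.
Proof.
move=> xz Ss xs; have [t [St tx ts]] := dense_beyond Sd c0 xs.
have zt : `|z - f t| <= c * 2%:R by apply: xz => //; rewrite distrC.
have ft : c * (n + 2)%:R <= `|f t - f s|.
  by rewrite leNgt -fstep// -leNgt.
have := ler_distD z (f t) (f s); rewrite (distrC (f t) z).
by move: ft; rewrite natrD mulrDr; lra.
Qed.

(** An intermediate point of [S] splits the distance into parts below [c * (n - 1)] and [c]; the
    bound [2 <= n] makes both radii positive. The part inside [S] stays strict, which compensates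
    for the closed ball in the other part. *)
Lemma step_image_lt (x z s : X) (n : nat) :
  step_image S c f x z -> S s -> (2 <= n)%N ->
  (`|x - s| < c * n%:R) = (`|z - f s| < c * n%:R).
Proof.
case: n => [//|[//|n]] xz Ss _.
have cn : c * n.+2%:R = c * n.+1%:R + c by rewrite -natr1 mulrDr mulr1.
have cn0 : 0 < c * n.+1%:R by rewrite mulr_gt0.
have step1 u v : S u -> S v -> (`|u - v| < c) = (`|f u - f v| < c).
  by move=> Su Sv; have := fstep 1 Su Sv; rewrite !mulr1.
rewrite cn; apply/idP/idP => h.
- have [t [St xt ts]] := dense_between Sd cn0 c0 h.
  have := xz _ _ St xt; have := ler_distD (f t) z (f s).
  by move: ts; rewrite step1//; lra.
- have [t [St zt ts]] := dense_between Sd cn0 c0 h.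
  have Sgt := gS St.
  rewrite -(gK St) -step1// in ts; rewrite -(gK St) in zt.
  have := ler_distD (g t) x s.
  suff : `|x - g t| <= c * n.+1%:R by lra.
  by rewrite leNgt; apply/negP => /(step_image_ge xz Sgt); lra.
Qed.

(** If [z] and [z'] differ, some [t] in [S] is within [2c] of [z] but not of [z'], whereas by
    [step_image_lt] both statements are equivalent to [|x - g t| < 2c]. *)
Lemma step_image_unique (x z z' : X) :
  step_image S c f x z -> step_image S c f x z' -> z = z'.
Proof.
move=> xz xz'; have [//|zz'] := eqVneq z z'; exfalso.
have zz'0 : c * 0%:R < `|z - z'| by rewrite mulr0 normr_gt0 subr_eq0.
have [t [St tz tz']] := dense_beyond Sd c0 zz'0.
have Sgt := gS St.
rewrite -(gK St) distrC -(step_image_lt xz)// in tz.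
by rewrite -(gK St) distrC leNgt -(step_image_lt xz')// tz in tz'.
Qed.

Lemma step_extension : reflexive_space X ->
  exists F : X -> X,
    [/\ forall s, S s -> F s = f s,
        forall x y n, (4 <= n)%N ->
          (`|x - y| < c * n%:R) = (`|F x - F y| < c * n%:R)
      & forall x y n, (4 <= n)%N -> `|x - y| = c * n%:R ->
        `|F x - F y| = c * n%:R].
Proof.
move=> Xrefl.
have [F xF] : {F : X -> X & forall x, step_image S c f x (F x)}.
  exists (fun x => projT1 (cid (step_image_nonempty x Xrefl))) => x.
  exact: projT2 (cid (step_image_nonempty x Xrefl)).
have FS s n x : S s -> (2 <= n)%N ->
    (`|x - s| < c * n%:R) = (`|F x - f s| < c * n%:R).
  by move=> Ss n2; exact: step_image_lt.
have Fstep x y n : (4 <= n)%N ->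
    (`|x - y| < c * n%:R) = (`|F x - F y| < c * n%:R).
  move: n => [|[|[|[|n]]]]// _.
  (* Both summands must be at least [2c] for [step_image_lt] to apply, hence the restriction to
     multiples from 4 on. *)
  have cn : c * n.+4%:R = c * n.+2%:R + c * 2%:R.
    by rewrite -mulrDr -natrD addn2.
  have cn0 : 0 < c * n.+2%:R by rewrite mulr_gt0.
  have c20 : 0 < c * 2%:R by rewrite mulr_gt0.
  rewrite cn; apply/idP/idP => h.
  - have [t [St xt ty]] := dense_between Sd cn0 c20 h.
    rewrite FS// in xt; rewrite distrC FS// distrC in ty.
    by have := ler_distD (f t) (F x) (F y); lra.
  - have [t [St xt ty]] := dense_between Sd cn0 c20 h.
    have Sgt := gS St.
    rewrite -(gK St) -FS// in xt; rewrite -(gK St) distrC -FS// distrC in ty.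
    by have := ler_distD (g t) x y; lra.
exists F; split => //.
- move=> s Ss; apply: (@step_image_unique s) => // t n St.
  by rewrite fstep// => /ltW.
- move=> x y n n4 xy; apply/eqP; rewrite eq_le; apply/andP; split; last first.
    by rewrite leNgt -Fstep// xy ltxx.
  (* If the image distance exceeded [c * n], a point of [S] beyond [F x] as seen from [F y] would
     pull back to a point less than [2c] from [x] and at least [c * (n + 2)] from [y]. *)
  rewrite leNgt; apply/negP => h.
  have [t [St tx ty]] := dense_beyond Sd c0 h.
  have Sgt := gS St.
  rewrite -(gK St) distrC -FS// in tx.
  rewrite -(gK St) distrC leNgt -FS ?addn2// -leNgt in ty.
  have := ler_distD x y (g t); rewrite (distrC y x) xy.
  by move: ty; rewrite -addn2 natrD mulrDr; lra.
Qed.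

End StepExtension.

(** * Step maps in strictly convex spaces *)

(** The midpoint of [u / r] and [v / r] has norm 1, so it is an extreme point of the ball and both
    ends coincide with it. *)
Lemma strictly_convex_eq (R : realType) (X : normedModType R) (r : R)
    (u v : X) :
  strictly_convex X -> 0 < r -> `|u| = r -> `|v| = r -> `|u + v| = r * 2%:R ->
  u = v.
Proof.
move=> Xsc r0 ur vr uvr; have rn : r != 0 by rewrite gt_eqF.
have rV : `|r^-1| = r^-1 by rewrite ger0_norm// invr_ge0 ltW.
have m1 : `|(r * 2%:R)^-1 *: (u + v)| = 1.
  by rewrite normrZ uvr ger0_norm ?invr_ge0 ?mulr_ge0 ?ltW// mulVf// mulf_neq0.
have [_ /(_ (r^-1 *: u) (r^-1 *: v) (2%:R^-1))] := Xsc _ m1.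
rewrite /unit_ball/= !normrZ rV ur vr mulVf// lexx => /(_ isT isT _ _)[||yx zx].
- by apply/andP; split; lra.
- rewrite scalerDr !scalerA; congr (_ *: _ + _ *: _); by field.
- have /(congr1 (fun x => r *: x)) : r^-1 *: u = r^-1 *: v by rewrite yx zx.
  by rewrite !scalerA divff// !scale1r.
Qed.

(** Archimedean principle that removes bounded errors from estimates along long progressions. *)
Lemma le_of_natmul_le (R : realType) (a b M : R) :
  (forall k : nat, k%:R * a <= k%:R * b + M) -> a <= b.
Proof.
move=> h; rewrite leNgt; apply/negP => ba.
have ab0 : 0 < a - b by rewrite subr_gt0.
have := h (Num.truncn (M / (a - b))).+1.
have := truncnS_gt (M / (a - b)); rewrite ltr_pdivrMr//; lra.
Qed.

Lemma not_line (R : realType) (V : lmodType R) (w : V) :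
  dim_ge2 V -> exists e : V, forall a, e <> a *: w.
Proof.
move=> [u [v uv]]; apply: contrapT => ne.
have line e : exists a, e = a *: w.
  apply: contrapT => nea; apply: ne; exists e => a ea; apply: nea.
  by exists a.
have [a ua] := line u; have [b vb] := line v.
have [] := uv b (- a).
  by rewrite ua vb !scalerA mulrC mulNr scaleNr subrr.
move=> b0 /eqP; rewrite oppr_eq0 => /eqP a0.
have [] := uv 1 0; last by move/eqP; rewrite oner_eq0.
by rewrite ua a0 !scale0r scaler0 addr0.
Qed.

(* The sphere of radius [r] is connected, so it contains [v] with
   [|w - v| = r] on an arc from [r w/|w|] to its antipode. *)
Lemma sum_of_sphere (R : realType) (X : normedModType R) (r : R) (w : X) :
  dim_ge2 X -> 0 < r -> `|w| <= r * 2%:R ->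
  exists v1 v2 : X, [/\ `|v1| = r, `|v2| = r & w = v1 + v2].
Proof.
move=> X2 r0 wr; have [w0|w0] := eqVneq w 0.
  have [e eP] := not_line (0 : X) X2.
  have e0 : e != 0 by apply/eqP => e0; apply: (eP 0); rewrite e0 scaler0.
  have er : `|(r / `|e|) *: e| = r.
    by rewrite normrZ normrM normfV normr_id divfK ?normr_eq0// gtr0_norm.
  exists ((r / `|e|) *: e), (- ((r / `|e|) *: e)).
  by rewrite normrN subrr.
have [e eP] := not_line w X2.
(* A path from [w] to [- w]. Its [e] component vanishes only at the ends of the unit interval, where
   the [w] component does not, so it avoids 0 and can be normalised to length [r]. *)
pose y (t : R) : X := (1 - 2%:R * t) *: w + (t * (1 - t)) *: e.
have y0 t : y t != 0.
  apply/eqP => yt; have [tt|tt] := eqVneq (t * (1 - t)) 0.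
    move/eqP: yt; rewrite /y tt scale0r addr0 scaler_eq0 (negPf w0) orbF.
    by move: tt => /eqP; rewrite mulf_eq0 => /orP[]/eqP t01 /eqP; lra.
  apply: (eP (- (1 - 2%:R * t) / (t * (1 - t)))).
  move/eqP: yt; rewrite /y addrC addr_eq0 => /eqP yt.
  by rewrite mulrC -scalerA scaleNr -yt scalerA mulVf// scale1r.
have yc (t : R) : y x @[x --> t] --> y t.
  apply: cvgD; apply: cvgZ.
  - by apply: cvgB; [exact: cvg_cst|apply: cvgM;
      [exact: cvg_cst|exact: cvg_id]].
  - exact: cvg_cst.
  - apply: cvgM; first exact: cvg_id.
    by apply: cvgB; [exact: cvg_cst|exact: cvg_id].
  - exact: cvg_cst.
pose h (t : R) : R := `|w - (r / `|y t|) *: y t|.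
have hc : continuous h.
  move=> t; apply: cvg_norm; apply: cvgB; first exact: cvg_cst.
  apply: cvgZ; last exact: yc.
  apply: cvgM; first exact: cvg_cst.
  apply: cvgV; first by rewrite normr_eq0.
  by apply: cvg_norm; exact: yc.
have wp : 0 < `|w| by rewrite normr_gt0.
(* At the start the distance is [||w| - r|], at most [r] because [|w| <= 2r]; at the end it is
   [|w| + r]. *)
have h0 : h 0 <= r.
  have -> : h 0 = `|(1 - r / `|w|) *: w|.
    by rewrite /h /y mulr0 subr0 mul0r scale1r scale0r addr0 scalerBl scale1r.
  rewrite normrZ -[X in _ * X]gtr0_norm// -normrM mulrBl mul1r divfK ?gt_eqF//.
  by rewrite ler_norml; lra.
have h1 : r <= h 1.
  have -> : h 1 = `|(1 + r / `|w|) *: w|.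
    have y1 : y 1 = - w.
      by rewrite /y subrr mulr0 scale0r addr0 mulr1 -[RHS]scaleN1r;
        congr (_ *: _); lra.
    by rewrite /h y1 normrN scalerN opprK scalerDl scale1r.
  rewrite normrZ ger0_norm ?addr_ge0 ?divr_ge0 ?(ltW r0)// mulrDl mul1r.
  by rewrite divfK ?gt_eqF// lerDr ltW.
have [|t _ ht] := @IVT R h 0 1 r ler01 (continuous_subspaceT hc).
  by rewrite ge_min le_max h0 h1 orbT.
exists ((r / `|y t|) *: y t), (w - (r / `|y t|) *: y t); split.
- by rewrite normrZ normrM normfV normr_id divfK ?normr_eq0// gtr0_norm.
- exact: ht.
- by rewrite addrC subrK.
Qed.

Section StepRigidity.
Context (R : realType) (X : normedModType R) (r : R) (F : X -> X).
Hypotheses (Xsc : strictly_convex X) (X2 : dim_ge2 X) (r0 : 0 < r).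
Hypothesis Fstep : forall x y n,
  (`|x - y| < r * n%:R) = (`|F x - F y| < r * n%:R).
Hypothesis Feq : forall x y n, `|x - y| = r * n%:R -> `|F x - F y| = r * n%:R.

(** Rounding [a] up to the next larger multiple of [r] adds at most [r]; hence [F] changes distances
    by at most [r]. *)
Let coarse (a b : R) : 0 <= a ->
  (forall n : nat, a < r * n%:R -> b < r * n%:R) -> b <= a + r.
Proof.
move=> a0 /(_ (Num.truncn (a / r)).+1).
rewrite mulrC -ltr_pdivrMr// truncnS_gt => /(_ isT).
have := truncn_le (a / r); rewrite divr_ge0 ?(ltW r0)// ler_pdivlMr//.
by rewrite -natr1; lra.
Qed.

Let coarse_le (x y : X) : `|F x - F y| <= `|x - y| + r.
Proof. by apply: coarse => // n; rewrite Fstep. Qed.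

Let coarse_ge (x y : X) : `|x - y| <= `|F x - F y| + r.
Proof. by apply: coarse => // n; rewrite -Fstep. Qed.

Definition constant_increment (w : X) := forall x y,
  F (x + w) - F x = F (y + w) - F y.

Let increment_iter (w : X) (x : X) (k : nat) :
  (forall j : nat,
     F (x + j%:R *: w + w) - F (x + j%:R *: w) = F (x + w) - F x) ->
  F (x + k%:R *: w) = F x + k%:R *: (F (x + w) - F x).
Proof.
move=> h; elim: k => [|k IHk]; first by rewrite !scale0r !addr0.
rewrite -natr1 !scalerDl !scale1r addrA -[LHS](subrK (F (x + k%:R *: w))) h IHk.
by set D := F (x + w) - F x; rewrite [LHS]addrC -addrA.
Qed.

Lemma sphere_constant_increment (v : X) : `|v| = r -> constant_increment v.
Proof.
move=> vr.
(* Consecutive images are at distance [r] and the outer two at distance [2r], so strict convexity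
   makes the two increments equal. *)
have step x : F (x + v + v) - F (x + v) = F (x + v) - F x.
  apply: (strictly_convex_eq Xsc r0).
  - by have := @Feq (x + v + v) (x + v) 1%N; rewrite mulr1; apply;
      rewrite addrAC subrr add0r.
  - by have := @Feq (x + v) x 1%N; rewrite mulr1; apply;
      rewrite addrAC subrr add0r.
  - rewrite addrA subrK; apply: Feq.
    by rewrite addrAC [x + v - x]addrAC subrr add0r -mulr2n -scaler_nat normrZ
      vr ger0_norm// mulrC.
have iter x k : F (x + k%:R *: v) = F x + k%:R *: (F (x + v) - F x).
  apply: increment_iter; elim=> [|j IHj]; first by rewrite scale0r addr0.
  by rewrite -natr1 scalerDl scale1r addrA step IHj.
move=> x y; apply/eqP; rewrite -subr_eq0 -normr_le0.
(* [k] times the difference of the two increments is [F (x + k v) - F (y + k v)] minus [F x - F y],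
   and each of these is bounded by [|x - y| + r] uniformly in [k]. *)
apply: (@le_of_natmul_le _ _ _ ((`|x - y| + r) * 2%:R)) => k.
rewrite mulr0 add0r -[X in X * `|_|](ger0_norm (ler0n R k)) -normrZ scalerBr.
have kE z : k%:R *: (F (z + v) - F z) = F (z + k%:R *: v) - F z.
  by rewrite iter addrAC subrr add0r.
rewrite !kE opprB [F y - _]addrC addrACA.
apply: le_trans (ler_normD _ _) _; rewrite mulrDr mulr1.
apply: lerD; last by rewrite [X in `|X|]addrC distrC; exact: coarse_le.
apply: le_trans (coarse_le _ _) _.
by rewrite opprD addrACA subrr addr0.
Qed.

Lemma small_constant_increment (w : X) : `|w| <= r * 2%:R ->
  constant_increment w.
Proof.
move=> /(sum_of_sphere X2 r0)[v1 [v2 [v1r v2r ->]]] x y.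
have E z : F (z + (v1 + v2)) - F z =
    (F (z + v1 + v2) - F (z + v1)) + (F (z + v1) - F z).
  by rewrite [in RHS]addrA subrK addrA.
by rewrite !E (sphere_constant_increment v2r (x + v1) (y + v1))
  (sphere_constant_increment v1r x y).
Qed.

(** Cut [x - y] into [k] equal vectors [w] of norm at most [2r]. Since [F] maps [y + j w] to
    [F y + j a] for every [j] with error at most [r] in distances, letting [j] grow gives
    [|a| = |w|]; then take [j = k]. *)
Lemma step_rigid (x y : X) : `|F x - F y| = `|x - y|.
Proof.
pose k := (Num.truncn (`|x - y| / (r * 2%:R))).+1.
pose w := k%:R^-1 *: (x - y).
have k0 : 0 < k%:R :> R by rewrite ltr0n.
have kw : x - y = k%:R *: w by rewrite scalerA divff ?scale1r// gt_eqF.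
have wr : `|w| <= r * 2%:R.
  rewrite normrZ gtr0_norm ?invr_gt0// mulrC ler_pdivrMr// mulrC.
  by rewrite -ler_pdivrMr ?mulr_gt0// ltW// truncnS_gt.
pose a := F (y + w) - F y.
have iter j : F (y + j%:R *: w) - F y = j%:R *: a.
  rewrite increment_iter; first by rewrite addrAC subrr add0r.
  by move=> i; exact: small_constant_increment.
have normE (j : nat) (z : X) : `|j%:R *: z| = j%:R * `|z|.
  by rewrite normrZ ger0_norm.
have jw j : y + j%:R *: w - y = j%:R *: w by rewrite addrAC subrr add0r.
have aw : `|a| = `|w|.
  apply/eqP; rewrite eq_le; apply/andP; split.
  - apply: (@le_of_natmul_le _ _ _ r) => j.
    by have := coarse_le (y + j%:R *: w) y; rewrite iter jw !normE.
  - apply: (@le_of_natmul_le _ _ _ r) => j.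
    by have := coarse_ge (y + j%:R *: w) y; rewrite iter jw !normE.
have -> : F x - F y = k%:R *: a by rewrite -iter -kw [y + _]addrC subrK.
by rewrite kw !normE aw.
Qed.

End StepRigidity.

(** The nonzero [v] allows the centre to be moved off a forbidden point; the ball is then shrunk to
    exclude that point, one list entry at a time. *)
Lemma dense_avoid (R : realType) (X : normedModType R) (S : set X) (v : X)
    (l : seq X) (x : X) (e : R) :
  dense S -> v != 0 -> 0 < e -> exists t, [/\ S t, `|t - x| < e & t \notin l].
Proof.
move=> Sd v0; have nv : 0 < `|v| by rewrite normr_gt0.
elim: l x e => [|a l IHl] x e e0.
  by have [t [St tx]] := dense_norm_ball Sd x e0; exists t.
have [x' [xx' x'a]] : exists x', `|x' - x| < e /\ x' != a.
  have [xa|xa] := eqVneq x a; last by exists x; rewrite subrr normr0.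
  have k0 : 0 < e / 2 / `|v| by rewrite !divr_gt0.
  exists (x + (e / 2 / `|v|) *: v); rewrite addrAC subrr add0r normrZ
    gtr0_norm//.
  split; first by rewrite divfK ?gt_eqF//; lra.
  by rewrite -subr_eq0 -xa addrAC subrr add0r scaler_eq0 gt_eqF.
have e'0 : 0 < Num.min (e - `|x' - x|) `|x' - a|.
  by rewrite lt_min subr_gt0 xx' normr_gt0 subr_eq0.
have [t [St]] := IHl x' _ e'0; rewrite lt_min => /andP[tx ta] tl.
exists t; split => //.
  by have := ler_distD x' t x; lra.
rewrite inE negb_or tl andbT; apply: contraTneq ta => ->.
by rewrite distrC ltxx.
Qed.

Lemma dense_many (R : realType) (X : normedModType R) (S : set X) (v : X)
    (l : seq X) (x : X) (e : R) (K : nat) :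
  dense S -> v != 0 -> 0 < e ->
  exists s : seq X, [/\ size s = K, uniq s
    & forall t, t \in s -> [/\ S t, `|t - x| < e & t \notin l]].
Proof.
move=> Sd v0 e0; elim: K => [|K [s [sK us sP]]]; first by exists [::].
have [t [St tx]] := dense_avoid (s ++ l) x Sd v0 e0.
rewrite mem_cat negb_or => /andP[ts tl].
exists (t :: s); split=> [||u]; first by rewrite /= sK.
  by rewrite /= ts.
by rewrite inE => /predU1P[->|/sP].
Qed.

(** Each pair has the same distance as its image and so equals it. Thus [f s] lies in both [{s, t}]
    and [{s, u}] for distinct [s], [t], [u]. *)
Lemma isometry_no_repeated_distance (R : realType) (X : normedModType R)
    (S : set X) (v : X) (f : X -> X) :
  dense S -> v != 0 -> no_repeated_distance S ->
  (forall s, S s -> S (f s)) ->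
  (forall s t, S s -> S t -> `|f s - f t| = `|s - t|) ->
  forall s, S s -> f s = s.
Proof.
move=> Sd v0 Snr fS fiso s Ss.
have [t [St _ ts]] := dense_avoid [:: s] s Sd v0 ltr01.
have [u [Su _]] := dense_avoid [:: s; t] s Sd v0 ltr01.
rewrite mem_seq1 in ts; rewrite !inE negb_or => /andP[us ut].
have fs_in w : S w -> w != s -> f s = s \/ f s = w.
  move=> Sw ws; have fsw : f s <> f w.
    move=> fsw; move: ws; rewrite -subr_eq0 -normr_eq0 distrC.
    by rewrite -fiso// fsw subrr normr0 eqxx.
  have sw : s <> w by move=> sw; rewrite sw eqxx in ws.
  have : [set f s; f w] (f s) by left.
  by rewrite (Snr _ _ _ _ (fS _ Ss) (fS _ Sw) Ss Sw fsw sw (fiso _ _ Ss Sw)).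
have [//|fst] := fs_in t St ts; have [//|fsu] := fs_in u Su us.
by move: ut; rewrite -fsu fst eqxx.
Qed.

Lemma step_bijection_id (R : realType) (X : normedModType R) (S : set X)
    (c : R) (f g : X -> X) :
  strictly_convex X -> reflexive_space X -> dim_ge2 X ->
  dense S -> no_repeated_distance S -> 0 < c ->
  (forall s, S s -> S (f s)) -> (forall s, S s -> S (g s)) ->
  (forall s, S s -> g (f s) = s) -> (forall s, S s -> f (g s) = s) ->
  (forall s t, S s -> S t -> `|s - t| < c <-> `|f s - f t| < c) ->
  forall s, S s -> f s = s.
Proof.
move=> Xsc Xrefl X2 Sd Snr c0 fS gS fK gK fc.
have [v v0] : exists v : X, v != 0.
  have [v vP] := not_line (0 : X) X2.
  by exists v; apply/eqP => v0; apply: (vP 0); rewrite v0 scaler0.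
have fstep s t n : S s -> S t ->
    (`|s - t| < c * n%:R) = (`|f s - f t| < c * n%:R).
  move=> Ss St; apply/idP/idP => h.
  - by apply: (step_map_chain Sd c0) h => // a b Sa Sb /fc; exact.
  - rewrite -(fK _ Ss) -(fK _ St).
    apply: (step_map_chain Sd c0) h; [|exact: fS|exact: fS] => a b Sa Sb ab.
    by apply/(fc _ _ (gS _ Sa) (gS _ Sb)); rewrite !gK.
have [F [Ff Fstep Feq]] := step_extension Sd c0 gS gK fstep Xrefl.
(* All positive multiples of [4c] are covered by the extension; [n = 0] is checked separately. *)
have r0 : 0 < c * 4%:R by rewrite mulr_gt0.
have iso x y : `|F x - F y| = `|x - y|.
  apply: (step_rigid Xsc X2 r0) => {}x {}y n; rewrite -!mulrA -!natrM.
  - by case: n => [|n]; [rewrite muln0 mulr0 !normr_lt0|rewrite Fstep//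
      leq_pmulr].
  - case: n => [|n]; last by apply: Feq; rewrite leq_pmulr.
    rewrite muln0 mulr0 => /eqP; rewrite normr_eq0 subr_eq0 => /eqP ->.
    by rewrite subrr normr0.
apply: (isometry_no_repeated_distance Sd v0 Snr fS) => s t Ss St.
by rewrite -!Ff.
Qed.

(** * Independent events *)

Section ProbabilityFacts.
Context (R : realType) (d : measure_display) (T : measurableType d).
Variable P : probability T R.

(** Independence passes to complements, by induction on their number: the event [D a] is moved from
    [l] to [m] and subtracted, which is why [m] is arbitrary. *)
Lemma probability_bigsetI_setC (I : eqType) (J : set I) (D : I -> set T)
    (q : R) :
  (forall i, J i -> measurable (D i)) ->
  (forall l : seq I, uniq l -> (forall i, i \in l -> J i) ->
     P (\big[setI/setT]_(i <- l) D i) = (q ^+ size l)%:E) ->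
  forall l m : seq I, uniq (l ++ m) -> (forall i, i \in l ++ m -> J i) ->
    P (\big[setI/setT]_(i <- l) ~` D i `&` \big[setI/setT]_(i <- m) D i) =
    ((1 - q) ^+ size l * q ^+ size m)%:E.
Proof.
move=> mD PD; elim=> [|a l IHl] m.
  by move=> um mJ; rewrite big_nil setTI PD//= expr0 mul1r.
rewrite cat_cons => alm aJ.
have perm_alm : perm_eq (a :: l ++ m) (l ++ a :: m).
  by rewrite perm_sym -[a :: m]cat1s perm_catCA.
have ulm : uniq (l ++ m) by case/andP: alm.
have lmJ i : i \in l ++ m -> J i by move=> h; apply: aJ; rewrite inE h orbT.
have mbig (Q : I -> set T) (s : seq I) :
    (forall i, i \in s -> measurable (Q i)) ->
    measurable (\big[setI/setT]_(i <- s) Q i).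
  by move=> mQ; rewrite big_seq; exact: bigsetI_measurable.
pose A := \big[setI/setT]_(i <- l) ~` D i `&` \big[setI/setT]_(i <- m) D i.
have mA : measurable A.
  apply: measurableI; apply: mbig => i il.
    by apply/measurableC/mD/lmJ; rewrite mem_cat il.
  by apply/mD/lmJ; rewrite mem_cat il orbT.
have mDa : measurable (D a) by apply/mD/aJ; rewrite inE eqxx.
have -> : \big[setI/setT]_(i <- a :: l) ~` D i `&` \big[setI/setT]_(i <- m) D i
    = A `\` D a.
  by rewrite big_cons setDE /A -setIA setIC.
have -> : P (A `\` D a) = (P A - P (A `&` D a))%E.
  by apply: measureD => //; exact: le_lt_trans (probability_le1 P mA) (ltry _).
have -> : A `&` D a =
    \big[setI/setT]_(i <- l) ~` D i `&` \big[setI/setT]_(i <- a :: m) D i.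
  by rewrite big_cons /A -setIA [D a `&` _]setIC.
rewrite /A (IHl m ulm lmJ) (IHl (a :: m)) -?(perm_uniq perm_alm)//; last first.
  by move=> i; rewrite -(perm_mem perm_alm); exact: aJ.
by rewrite -EFinB/=; congr EFin; rewrite !exprS; ring.
Qed.

Lemma negligible_geometric (r : R) (N : set T) :
  0 <= r < 1 ->
  (forall K : nat, exists B : set T,
     [/\ measurable B, N `<=` B & P B = (r ^+ K)%:E]) ->
  P.-negligible N.
Proof.
move=> /andP[r0 r1] /choice[B BP].
have mB : measurable (\bigcap_K B K).
  by apply: bigcap_measurable => [|K _]; [exists 0%N|have [] := BP K].
exists (\bigcap_K B K); split => //; last first.
  by move=> w Nw K _; have [_ + _] := BP K; exact.
have PB K : (P (\bigcap_K B K) <= (r ^+ K)%:E)%E.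
  have [mBK _ <-] := BP K; apply: le_measure; rewrite ?inE//.
  exact: bigcap_inf.
have fP : P (\bigcap_K B K) \is a fin_num.
  by rewrite fin_num_measure.
rewrite -(fineK fP); congr EFin; apply/eqP; rewrite eq_le fine_ge0 ?andbT//.
have rK : (r ^+ K) @[K --> \oo] --> (0 : R).
  by apply: cvg_expr; rewrite ger0_norm.
apply: (cvgr_to_ge rK); apply: nearW => K.
by rewrite -lee_fin fineK.
Qed.

Lemma negligible_bigcup_countable (I : Type) (A : set I) (N : I -> set T) :
  countable A -> (forall i, A i -> P.-negligible (N i)) ->
  P.-negligible (\bigcup_(i in A) N i).
Proof.
move=> /countable_injP[h hinj] AN.
have : P.-negligible (\bigcup_k \bigcup_(i in [set i | A i /\ h i = k]) N i).
  apply: negligible_bigcup => k.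
  have [[i [Ai hik]]|none] := pselect (exists i, A i /\ h i = k).
    apply: negligibleS (AN i Ai) => w [j [Aj hjk] Nj].
    suff <- : j = i by [].
    by apply: hinj; rewrite ?inE// hjk.
  apply: negligibleS (negligible_set0 P) => w [j Ajk _].
  by apply: none; exists j.
by apply: negligibleS => w [i Ai Ni]; exists (h i) => //; exists i.
Qed.

End ProbabilityFacts.

(** * Random graphs *)

Lemma set2_injr (T : Type) (x s t : T) :
  s <> x -> [set x; s] = [set x; t] -> s = t.
Proof.
by move=> sx e; have : [set x; s] s by [right]; rewrite e => -[].
Qed.

Lemma near_pair_lt1 (R : realType) (X : normedModType R) (S : set X) (x y : X) :
  near_pairs S [set x; y] -> `|x - y| < 1.
Proof.
move=> [a [b [Sa Sb ab ab1 e]]].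
have [|] : [set a; b] x by rewrite -e; left.
all: have [|] : [set a; b] y by rewrite -e; right.
all: by move=> -> ->; rewrite ?subrr ?normr0// distrC.
Qed.

Section RandomGraphFacts.
Context (R : realType) (d : measure_display) (T : measurableType d).
Context (P : probability T R) (X : normedModType R) (S : set X) (p : R).
Hypotheses (Sd : dense S) (p01 : 0 < p < 1).
Variable v : X.
Hypothesis v0 : v != 0.

Lemma random_graph_bigsetI (G : T -> set (set X)) (l : seq (set X)) :
  random_graph P S p G -> uniq l -> (forall e, e \in l -> near_pairs S e) ->
  P (\big[setI/setT]_(e <- l) edge_event G e) = (p ^+ size l)%:E.
Proof.
move=> [_ _ PG Gind] ul lS.
have lF : [set` [fset e in l]%fset] = [set` l].
  by apply/seteqP; split=> e /=; rewrite inE.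
have := Gind [fset e in l]%fset; rewrite lF bigcap_seq => -> //.
have -> : (\prod_(e <- [fset e in l]%fset) P (edge_event G e) =
           \prod_(e <- l) P (edge_event G e))%E.
  apply: perm_big; apply: uniq_perm => //.
  by move=> e; rewrite inE.
elim: l lS {ul lF} => [|e l IHl] lS; first by rewrite big_nil.
have leS e' : e' \in l -> near_pairs S e' by move=> h; apply: lS;
  rewrite inE h orbT.
by rewrite big_cons IHl// PG -?EFinM ?exprS//; apply: lS; rewrite inE eqxx.
Qed.

(** Any [K] points of [S] in a small ball within reach of both [x] and [y] are independent
    candidates, each successful with probability [p ^+ 2], so all fail with probability
    [(1 - p ^+ 2) ^+ K]. *)
Lemma common_neighbour_negligible (G : T -> set (set X)) (x y : X) :
  random_graph P S p G -> S x -> S y -> x <> y -> `|x - y| < 2%:R ->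
  P.-negligible [set w | ~ exists s,
    [/\ S s, s <> x, s <> y, G w [set x; s] & G w [set s; y]]].
Proof.
move=> Grg Sx Sy xy xy2; have [_ mG _ _] := Grg.
have [t [St xt ty]] := @dense_between _ _ _ Sd x y 1 1 ltr01 ltr01 xy2.
pose e := Num.min (1 - `|x - t|) (1 - `|t - y|).
have e0 : 0 < e by rewrite lt_min !subr_gt0 xt.
pose J := [set s | [/\ S s, `|s - t| < e & s \notin [:: x; y]]].
have JP s : J s -> [/\ s <> x, s <> y, near_pairs S [set x; s]
  & near_pairs S [set s; y]].
  move=> [Ss]; rewrite lt_min !inE negb_or => /andP[h1 h2]
    /andP[/eqP sx /eqP sy].
  split => //.
  - exists x, s; split=> //; first by move=> /esym.
    by have := ler_distD t x s; rewrite (distrC t s); lra.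
  - exists s, y; split=> //.
    by have := ler_distD t s y; lra.
pose D s := edge_event G [set x; s] `&` edge_event G [set s; y].
have mD s : J s -> measurable (D s).
  by move=> /JP[_ _ ? ?]; apply: measurableI; exact: mG.
have PD l : uniq l -> (forall s, s \in l -> J s) ->
    P (\big[setI/setT]_(s <- l) D s) = ((p ^+ 2) ^+ size l)%:E.
  move=> ul lJ.
  (* The [2 * size l] pairs are distinct, so their edge events are jointly independent. *)
  pose m := [seq [set x; s] | s <- l] ++ [seq [set s; y] | s <- l].
  have -> : \big[setI/setT]_(s <- l) D s =
      \big[setI/setT]_(e <- m) edge_event G e.
    by rewrite big_split/= /m big_cat/= !big_map.
  rewrite (random_graph_bigsetI Grg).
  - by rewrite size_cat !size_map addnn -mul2n exprM.
  - rewrite cat_uniq; apply/and3P; split.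
    + rewrite map_inj_in_uniq// => s s' /lJ/JP[sx _ _ _] _.
      exact: set2_injr sx.
    + apply/hasPn => _ /mapP[s /lJ/JP[sx _ _ _] ->]; apply/negP =>
        /mapP[s' _ e'].
      have : [set s; y] x by rewrite e'; left.
      by case=> [/esym|].
    + rewrite map_inj_in_uniq// => s s' /lJ/JP[_ sy _ _] _.
      by rewrite ![[set _; y]]setUC; exact: set2_injr sy.
  - move=> _e; rewrite mem_cat => /orP[] /mapP[s /lJ/JP[_ _ ? ?] ->]//.
have [p0 p1] := andP p01.
apply: (@negligible_geometric _ _ _ _ (1 - p ^+ 2)).
  rewrite subr_ge0 ltrBlDr ltrDl exprn_gt0// andbT.
  by rewrite exprn_ile1// ltW.
move=> K; have [l [lK ul lP]] := dense_many [:: x; y] t K Sd v0 e0.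
have mDC : measurable (\big[setI/setT]_(s <- l) ~` D s).
  by rewrite big_seq; apply: bigsetI_measurable => s /lP Js;
    exact/measurableC/mD.
exists (\big[setI/setT]_(s <- l) ~` D s); split => //.
- move=> w nw; rewrite -bigcap_seq => s /lP Js [Gxs Gsy].
  have [sx sy _ _] := JP _ Js; apply: nw; exists s; split => //.
  by case: Js.
- have := probability_bigsetI_setC mD PD (l := l) (m := [::]).
  by rewrite cats0 big_nil setIT expr0 mulr1 lK => ->.
Qed.

Lemma graph_sigma_bigsetI (G : T -> set (set X)) (A : set X -> set T)
    (l : seq (set X)) :
  (forall e, e \in l -> graph_sigma S G (A e)) ->
  graph_sigma S G (\big[setI/setT]_(e <- l) A e).
Proof.
move=> h; rewrite big_seq.
exact: (@bigsetI_measurable _ (g_sigma_algebraType _)).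
Qed.

(** Among [K] pairs at a common point [x], each is an edge of [G] but not of [H] with probability
    [p * (1 - p)], independently; agreement excludes all these events. *)
Lemma same_edges_negligible (G H : T -> set (set X)) :
  random_graph P S p G -> random_graph P S p H -> independent_graphs P S G H ->
  P.-negligible [set w | forall e, near_pairs S e -> (G w e <-> H w e)].
Proof.
move=> Grg Hrg GHind; have [_ mG _ _] := Grg; have [_ mH _ _] := Hrg.
have [p0 p1] := andP p01.
pose D e := edge_event G e `&` ~` edge_event H e.
have mD e : near_pairs S e -> measurable (D e).
  by move=> ne; apply: measurableI; [exact: mG|exact/measurableC/mH].
have sG e : near_pairs S e -> graph_sigma S G (edge_event G e).
  by move=> ne; apply: sub_sigma_algebra; exists e.
have sH e : near_pairs S e -> graph_sigma S H (~` edge_event H e).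
  by move=> ne; apply: sigma_algebraC; apply: sub_sigma_algebra; exists e.
have PHC l : uniq l -> (forall e, e \in l -> near_pairs S e) ->
    P (\big[setI/setT]_(e <- l) ~` edge_event H e) = ((1 - p) ^+ size l)%:E.
  move=> ul lS.
  have := probability_bigsetI_setC mH (fun l =>
    @random_graph_bigsetI H l Hrg) (l := l) (m := [::]).
  by rewrite cats0 big_nil setIT expr0 mulr1 => ->.
have PD l : uniq l -> (forall e, e \in l -> near_pairs S e) ->
    P (\big[setI/setT]_(e <- l) D e) = ((p * (1 - p)) ^+ size l)%:E.
  move=> ul lS; rewrite big_split/= GHind; last 2 first.
  - by apply: graph_sigma_bigsetI => e /lS; exact: sG.
  - by apply: graph_sigma_bigsetI => e /lS; exact: sH.
  by rewrite (random_graph_bigsetI Grg)// PHC// -EFinM exprMn.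
apply: (@negligible_geometric _ _ _ _ (1 - p * (1 - p))).
  by apply/andP; split; nra.
move=> K; have [x [Sx _]] := dense_norm_ball Sd 0 ltr01.
have [l [lK ul lP]] := dense_many [:: x] x K Sd v0 ltr01.
have lx s : s \in l -> s <> x by move=> /lP[_ _]; rewrite mem_seq1 => /eqP.
pose m := [seq [set x; s] | s <- l].
have mS e : e \in m -> near_pairs S e.
  move=> /mapP[s sl ->]; have [Ss sx1 _] := lP _ sl; exists x, s; split => //.
    by move=> /esym; exact: lx.
  by rewrite distrC.
have um : uniq m.
  by rewrite map_inj_in_uniq// => s s' /lx sx _; exact: set2_injr sx.
have mK : size m = K by rewrite size_map.
have mDC : measurable (\big[setI/setT]_(e <- m) ~` D e).
  by rewrite big_seq; apply: bigsetI_measurable => e /mS Js;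
    exact/measurableC/mD.
exists (\big[setI/setT]_(e <- m) ~` D e); split => //.
- by move=> w ew; rewrite -bigcap_seq => e /mS ne [Ge]; apply;
    exact: (ew e ne).1.
- have := probability_bigsetI_setC mD PD (l := m) (m := [::]).
  by rewrite cats0 big_nil setIT expr0 mulr1 mK => ->.
Qed.

End RandomGraphFacts.

(** * Isomorphisms between graphs with common neighbours *)

Section GraphDistance.
Context (R : realType) (X : normedModType R) (S : set X).

Definition has_common_neighbours (G : set (set X)) :=
  forall x y, S x -> S y -> x <> y -> `|x - y| < 2%:R ->
    exists s, [/\ S s, s <> x, s <> y, G [set x; s] & G [set s; y]].

(** Only one implication on edges is assumed, so the lemma applies to an isomorphism and, with [G]
    and [H] exchanged, to its inverse. *)
Lemma iso_preserves_lt2 (G H : set (set X)) (f : X -> X) (s t : X) :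
  has_common_neighbours G -> H `<=` near_pairs S ->
  (forall x, S x -> S (f x)) ->
  (forall x y, S x -> S y -> x <> y -> G [set x; y] -> H [set f x; f y]) ->
  S s -> S t -> `|s - t| < 2%:R -> `|f s - f t| < 2%:R.
Proof.
move=> Gcn HS fS fGH Ss St st.
have [->|/eqP sneqt] := eqVneq s t; first by rewrite subrr normr0.
have [u [Su us ut Gsu Gut]] := Gcn s t Ss St sneqt st.
have h1 := near_pair_lt1 (HS _ (fGH _ _ Ss Su (nesym us) Gsu)).
have h2 := near_pair_lt1 (HS _ (fGH _ _ Su St ut Gut)).
by have := ler_distD (f u) (f s) (f t); lra.
Qed.

Lemma graph_iso_id (G H : set (set X)) (f : X -> X) :
  strictly_convex X -> reflexive_space X -> dim_ge2 X ->
  dense S -> no_repeated_distance S ->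
  G `<=` near_pairs S -> H `<=` near_pairs S ->
  has_common_neighbours G -> has_common_neighbours H ->
  set_bij S S f ->
  (forall x y, S x -> S y -> x <> y -> (G [set x; y] <-> H [set f x; f y])) ->
  forall s, S s -> f s = s.
Proof.
move=> Xsc Xrefl X2 Sd Snr GS HS Gcn Hcn [fS finj fsurj] fGH.
have /choice[g gP] : forall s, exists t, S s -> S t /\ f t = s.
  move=> s; have [Ss|nSs] := pselect (S s); last by exists s.
  by have [t St ft] := fsurj s Ss; exists t.
have gS s : S s -> S (g s) by move=> /gP[].
have gK s : S s -> f (g s) = s by move=> /gP[].
have fS' s : S s -> S (f s) by move=> Ss; apply: fS.
have fK s : S s -> g (f s) = s.
  by move=> Ss; apply: finj; rewrite ?inE ?gK//; [exact/gS/fS'|exact: fS'].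
apply: (step_bijection_id (c := 2%:R) Xsc Xrefl X2 Sd Snr _ fS' gS fK gK) =>
  // s t Ss St.
split.
  apply: (iso_preserves_lt2 Gcn HS fS' _ Ss St) => x y Sx Sy xy.
  exact: (fGH x y Sx Sy xy).1.
rewrite -[X in _ -> `|X - _| < _](fK _ Ss) -[X in _ -> `|_ - X| < _](fK _ St).
apply: (iso_preserves_lt2 Hcn GS gS) => [x y Sx Sy xy Hxy||];
  [|exact: fS'|exact: fS'].
apply/fGH; [exact: gS|exact: gS| |by rewrite !gK].
by move=> gxy; apply: xy; rewrite -(gK _ Sx) -(gK _ Sy) gxy.
Qed.

End GraphDistance.

Theorem corollary4 (R : realType) (X : completeNormedModType R)
    (S : set X) (p : R) :
  0 < p < 1 ->
  strictly_convex X -> reflexive_space X -> dim_ge2 X ->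
  countable S -> dense S -> no_repeated_distance S ->
  strongly_non_rado S p.
Proof.
move=> p01 Xsc Xrefl X2 Sc Sd Snr d T P G H Grg Hrg GHind.
have [v v0] : exists v : X, v != 0.
  have [v vP] := not_line (0 : X) X2.
  by exists v; apply/eqP => v0; apply: (vP 0); rewrite v0 scaler0.
pose N (K : T -> set (set X)) (x y : X) := [set w | ~ exists s,
  [/\ S s, s <> x, s <> y, K w [set x; s] & K w [set s; y]]].
(* Countability of [S] makes the union of the exceptional sets over these pairs negligible. *)
pose A := [set z : X * X | [/\ S z.1, S z.2, z.1 <> z.2 & `|z.1 - z.2| < 2%:R]].
have Ac : countable A.
  apply: (@sub_countable _ _ _ (S `*` S)); last exact: countableX.
  by apply: subset_card_le => -[x y] [].
have NA K : random_graph P S p K ->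
    P.-negligible (\bigcup_(z in A) N K z.1 z.2).
  move=> Krg; apply: negligible_bigcup_countable => // -[x y] [/= Sx Sy xy xy2].
  exact: (common_neighbour_negligible Sd p01 v0 Krg).
have cn K w : ~ (\bigcup_(z in A) N K z.1 z.2) w ->
  has_common_neighbours S (K w).
  move=> nN x y Sx Sy xy xy2; apply: contrapT => nex; apply: nN.
  by exists (x, y).
have := negligibleU (same_edges_negligible Sd p01 v0 Grg Hrg GHind)
  (negligibleU (NA G Grg) (NA H Hrg)).
apply: negligibleS => w /contrapT[f [fbij fGH]].
apply: contrapT => /not_orP[nid /not_orP[/cn Gcn /cn Hcn]].
have [GS _ _ _] := Grg; have [HS _ _ _] := Hrg.
have fid := graph_iso_id Xsc Xrefl X2 Sd Snr (GS w) (HS w) Gcn Hcn fbij fGH.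
(* As [f] is the identity on [S], the two graphs agree on all near pairs, which is the first
   exceptional event. *)
apply: nid => _ [x [y [Sx Sy xy _ ->]]].
by have := fGH x y Sx Sy xy; rewrite !fid.
Qed.
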